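(* Consider classifiers that do not use the protected attribute. For $\mathrm{Dis}\in\{\mathrm{DD},\mathrm{DO},\mathrm{PD}\}$ suppose that $\eta^Y(X)$ and $w_{\mathrm{Dis}}(X)$ have probability density functions, the boundary sets $\{x:\eta^Y(x)=\frac12+\frac t2w_{\mathrm{Dis}}(x)\}$, $t\in\mathbb R$, being of $\mathbb P_X$-measure zero. For $\delta\ge0$, let $\widetilde{\mathbb P}^{\delta}_{\mathrm{DD}},\widetilde{\mathbb P}^{\delta}_{\mathrm{DO}},\widetilde{\mathbb P}^{\delta}_{\mathrm{PD}}$ be distributions of a triple $(\widetilde X,\widetilde A,\widetilde Y)$ on $\mathcal X\times\{0,1\}^2$, under each of which the conditional law of $\widetilde X$ given $\widetilde A=a,\widetilde Y=y$ equals $\mathbb P_{X\mid A=a,Y=y}$ for all $(a,y)\in\{0,1\}^2$, and for $(a,y)\in\{0,1\}^2$ $$\widetilde{\mathbb P}^{\delta}_{\mathrm{DD}}(\widetilde A=a,\widetilde Y=y)=c_{\mathrm{DD}}(\delta)\Big(1+\frac{(2a-1)(1-2y)\,t_{X,\mathrm{DD}}(\delta)}{p_a}\Big)p_{a,y},$$ $$\widetilde{\mathbb P}^{\delta}_{\mathrm{DO}}(\widetilde A=a,\widetilde Y=y)=c_{\mathrm{DO}}(\delta)\Big(1+\frac{(1-2a)\,y\,t_{X,\mathrm{DO}}(\delta)}{p_{a,y}}\Big)p_{a,y},$$ $$\widetilde{\mathbb P}^{\delta}_{\mathrm{PD}}(\widetilde A=a,\widetilde Y=y)=c_{\mathrm{PD}}(\delta)\Big(1+\frac{(2a-1)(1-y)\,t_{X,\mathrm{PD}}(\delta)}{p_{a,y}}\Big)p_{a,y},$$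 where $c_{\mathrm{DD}}(\delta),c_{\mathrm{DO}}(\delta),c_{\mathrm{PD}}(\delta)>0$ are such that in each case the four probabilities sum to $1$. Then the unconstrained Bayes-optimal classifiers for $\widetilde{\mathbb P}^{\delta}_{\mathrm{DD}},\widetilde{\mathbb P}^{\delta}_{\mathrm{DO}},\widetilde{\mathbb P}^{\delta}_{\mathrm{PD}}$ are $\delta$-fair Bayes-optimal classifiers for $\mathbb P$ under demographic parity, equality of opportunity, and predictive equality, respectively.
   Context: Let $(X,A,Y)\sim\mathbb P$ be a random triple with values in $\mathcal X\times\{0,1\}\times\{0,1\}$, with $p_a=\mathbb P(A=a)$, $p_{a,y}=\mathbb P(A=a,Y=y)>0$, $\eta^Y(x)=\mathbb P(Y=1\mid X=x)$, $\eta^A(x)=\mathbb P(A=1\mid X=x)$, $\eta^Y_{A=a}(x)=\mathbb P(Y=1\mid A=a,X=x)$; $\mathbb P_X$ and $\mathbb P_{X\mid A=a,Y=y}$ are the (conditional) laws of $X$. $I(\cdot)$ is the indicator function. The protected attribute is not available for prediction: a classifier is a measurable $f:\mathcal X\to[0,1]$ with prediction $\widehat Y_f\mid X\sim\mathrm{Bernoulli}(f(X))$, conditionally independent of $(A,Y)$ given $X$; $R(f)=\mathbb P(Y\ne\widehat Y_f)$. The unconstrained Bayes-optimal classifier for a distribution minimizes the misclassification error under that distribution among such classifiers. The disparity measures are $\mathrm{DD}(f)=\mathbb P(\widehat Y_f=1\mid A=1)-\mathbb P(\widehat Y_f=1\mid A=0)$ (demographic parity), $\mathrm{DO}(f)=\mathbb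 P(\widehat Y_f=1\mid A=1,Y=1)-\mathbb P(\widehat Y_f=1\mid A=0,Y=1)$ (equality of opportunity), $\mathrm{PD}(f)=\mathbb P(\widehat Y_f=1\mid A=1,Y=0)-\mathbb P(\widehat Y_f=1\mid A=0,Y=0)$ (predictive equality). A $\delta$-fair Bayes-optimal classifier under $\mathrm{Dis}$ is any element of $\operatorname{argmin}_{f:\mathcal X\to[0,1]}\{R(f):|\mathrm{Dis}(f)|\le\delta\}$. Weighting functions: $w_{\mathrm{DD}}(x)=\frac{\eta^A(x)}{p_1}-\frac{1-\eta^A(x)}{p_0}$, $w_{\mathrm{DO}}(x)=\frac{\eta^Y_{A=1}(x)\eta^A(x)}{p_{1,1}}-\frac{\eta^Y_{A=0}(x)(1-\eta^A(x))}{p_{0,1}}$, $w_{\mathrm{PD}}(x)=\frac{(1-\eta^Y_{A=1}(x))\eta^A(x)}{p_{1,0}}-\frac{(1-\eta^Y_{A=0}(x))(1-\eta^A(x))}{p_{0,0}}$. For $\mathrm{Dis}\in\{\mathrm{DD},\mathrm{DO},\mathrm{PD}\}$ and $\delta\ge0$, $$t_{X,\mathrm{Dis}}(\delta)=\operatorname*{argmin}_t\Big\{|t|:\Big|\int_{\mathcal X}w_{\mathrm{Dis}}(x)\,I\Big(\eta^Y(x)>\tfrac12+\tfrac t2w_{\mathrm{Dis}}(x)\Big)d\mathbb P_X(x)\Big|\le\delta\Big\}.$$ *)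

(* Defs.v *)
From HB Require Import structures.
From mathcomp Require Import all_boot all_order all_algebra.
From mathcomp Require Import all_classical all_reals all_analysis.

Set Implicit Arguments.
Unset Strict Implicit.
Unset Printing Implicit Defensive.
Import Order.TTheory GRing.Theory Num.Theory.

Local Open Scope classical_set_scope.
Local Open Scope ring_scope.

Section Defs.
Context {d : measure_display} {T : measurableType d} {R : realType}.

(* A distribution of a triple (X, A, Y) is a probability on T * bool * bool;
   label 1 is true and label 0 is false. *)
Notation triple := (T * bool * bool)%type.

Definition tX (z : triple) : T := z.1.1.
Definition tA (z : triple) : bool := z.1.2.
Definition tY (z : triple) : bool := z.2.

Lemma measurable_tX : measurable_fun [set: triple] tX.
Proof. exact: (measurableT_comp measurable_fst measurable_fst). Qed.

HB.instance Definition _ :=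
  isMeasurableFun.Build _ _ _ _ tX measurable_tX.

Definition lawX (P : probability triple R) : probability T R :=
  distribution P (tX : {RV P >-> T}).

Definition pA (P : probability triple R) (a : bool) : R :=
  fine (P [set z | tA z = a]).

Definition pAY (P : probability triple R) (a y : bool) : R :=
  fine (P [set z | tA z = a /\ tY z = y]).

(* The law of X conditionally on A = a, Y = y; meaningful if 0 < pAY P a y. *)
Definition lawX_given (P : probability triple R) (a y : bool) (B : set T) : R :=
  fine (P [set z | [/\ B (tX z), tA z = a & tY z = y]]) / pAY P a y.

(* g is a version of x |-> P(E | C, X = x), that is, of the conditional
   probability of E given X under P(. | C) (both sides of the defining identity
   being multiplied by P(C)). Such a g is determined only up to a null set of
   the law of X given C. *)
Definition cond_prob_version (P : probability triple R) (E C : set triple)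
    (g : T -> R) : Prop :=
  measurable_fun [set: T] g /\
  forall B : set T, measurable B ->
    (P (E `&` (C `&` tX @^-1` B)) =
     \int[P]_(z in C `&` tX @^-1` B) (g (tX z))%:E)%E.

Definition is_classifier (f : T -> R) : Prop :=
  measurable_fun [set: T] f /\ forall x, 0 <= f x <= 1.

(* The joint law of ((X, A, Y), Yhat_f): given (X, A, Y), the prediction Yhat_f
   is Bernoulli(f(X)), hence is independent of (A, Y) given X. *)
Definition joint_law (P : probability triple R) (f : T -> R)
    (E : set (triple * bool)) : \bar R :=
  (\int[P]_z bernoulli_prob (f (tX z)) (xsection E z))%E.

Definition risk (P : probability triple R) (f : T -> R) : R :=
  fine (joint_law P f [set u | tY u.1 <> u.2]).

(* P(Yhat_f = 1 | C), for an event C in terms of (X, A, Y). *)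
Definition positive_rate (P : probability triple R) (f : T -> R)
    (C : set triple) : R :=
  fine (joint_law P f [set u | u.2 = true /\ C u.1]) / fine (P C).

Inductive disparity := DD | DO | PD.

Definition dis_group (D : disparity) (a : bool) : set triple :=
  match D with
  | DD => [set z | tA z = a]
  | DO => [set z | tA z = a /\ tY z = true]
  | PD => [set z | tA z = a /\ tY z = false]
  end.

Definition dis (D : disparity) (P : probability triple R) (f : T -> R) : R :=
  positive_rate P f (dis_group D true) - positive_rate P f (dis_group D false).

Definition argmin {U : Type} (C : set U) (F : U -> R) : set U :=
  [set u | C u /\ forall v, C v -> F u <= F v].

Definition bayes_optimal (P : probability triple R) : set (T -> R) :=
  argmin [set f | is_classifier f] (risk P).

Definition fair_bayes_optimal (D : disparity) (delta : R)
    (P : probability triple R) : set (T -> R) :=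
  argmin [set f | is_classifier f /\ `|dis D P f| <= delta] (risk P).

(* etaA x is P(A = 1 | X = x), and etaYA a x is P(Y = 1 | A = a, X = x). *)
Definition weight (D : disparity) (P : probability triple R)
    (etaA : T -> R) (etaYA : bool -> T -> R) (x : T) : R :=
  match D with
  | DD => etaA x / pA P true - (1 - etaA x) / pA P false
  | DO => etaYA true x * etaA x / pAY P true true
          - etaYA false x * (1 - etaA x) / pAY P false true
  | PD => (1 - etaYA true x) * etaA x / pAY P true false
          - (1 - etaYA false x) * (1 - etaA x) / pAY P false false
  end.

Definition threshold_dis (P : probability triple R) (etaY w : T -> R) (t : R) : R :=
  \int[lawX P]_x (w x * \1_[set x' | etaY x' > 2^-1 + t / 2 * w x'] x).

(* The argmin is chosen arbitrarily if it is not unique, and is 0 by convention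
   if there is none. *)
Definition t_opt (P : probability triple R) (etaY w : T -> R) (delta : R) : R :=
  xget 0 (argmin [set t | `|threshold_dis P etaY w t| <= delta]
                 (fun t => `|t|)).

Definition has_pdf (mu : {measure set T -> \bar R}) (h : T -> R) : Prop :=
  exists g : R -> R,
    [/\ measurable_fun [set: R] g, (forall r, 0 <= g r) &
        forall B : set R, measurable B ->
          (mu (h @^-1` B) = \int[lebesgue_measure]_(r in B) (g r)%:E)%E].

(* The factor by which p_{a,y} is multiplied, up to the normalizing constant. *)
Definition reweight (D : disparity) (P : probability triple R) (t : R)
    (a y : bool) : R :=
  match D with
  | DD => 1 + (2 * a%:R - 1) * (1 - 2 * y%:R) * t / pA P a
  | DO => 1 + (1 - 2 * a%:R) * y%:R * t / pAY P a y
  | PD => 1 + (2 * a%:R - 1) * (1 - y%:R) * t / pAY P a y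
  end.

(* The conditional law of X given A = a, Y = y under Q is not defined when
   that event is Q-null, and is then not constrained. *)
Definition is_reweighting (D : disparity) (P : probability triple R) (t : R)
    (Q : probability triple R) : Prop :=
  (exists2 c : R, 0 < c &
     forall a y, pAY Q a y = c * reweight D P t a y * pAY P a y) /\
  (forall a y, 0 < pAY Q a y ->
     forall B, measurable B -> lawX_given Q a y B = lawX_given P a y B).

End Defs.

(* Main.v *)
Require Import Defs.
From HB Require Import structures.
From mathcomp Require Import all_boot all_order all_algebra.
From mathcomp Require Import all_classical all_reals all_analysis.
From mathcomp Require Import measurable_realfun ring lra.

Import numFieldNormedType.Exports.
Local Open Scope charge_scope.
Import Order.TTheory GRing.Theory Num.Theory.
Local Open Scope classical_set_scope.
Local Open Scope ring_scope.

(** The sublaw of [S] is the finite measure [B |-> P(X in B, (A, Y) in S)].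
    Reweighting the four sublaws of the cells [(a, y)] turns the risk under [Q]
    into the Lagrangian [K + c * (risk P f + t * dis D P f)], [c > 0].  Writing
    [dis] and [risk] as integrals against the law of [X], the Lagrangian is
    minimized pointwise by the rule [etaY > 1/2 + t/2 w], and every minimizer
    agrees with that rule almost everywhere since the boundary is null; so its
    disparity is [D(t) = threshold_dis t].  Comparing minimizers at two
    multipliers shows that [D] is antitone; it is continuous by dominated
    convergence.  Hence the multiplier [t] of least absolute value with
    [|D(t)| <= delta] exists and satisfies [t * D(t) = |t| * delta]
    (complementary slackness), and Lagrangian duality concludes. *)

(** * Densities between finite measures *)

Section density.
Context {d : measure_display} {T : measurableType d} {R : realType}.
Implicit Types (nu mu : {finite_measure set T -> \bar R}) (g h : T -> R).

(** The density is real-valued and of arbitrary sign because versions of conditional probabilities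
    are fixed only up to null sets and may leave [[0, 1]] there. *)
Definition has_density nu mu g : Prop :=
  measurable_fun [set: T] g /\
  forall B : set T, measurable B -> nu B = (\int[mu]_(x in B) (g x)%:E)%E.

Lemma eq_has_density {nu nu' mu mu' : {finite_measure set T -> \bar R}} {g} :
  (forall B, measurable B -> nu B = nu' B) ->
  (forall B, measurable B -> mu B = mu' B) ->
  has_density nu mu g -> has_density nu' mu' g.
Proof.
move=> nunu' mumu' [mg nug]; split=> // B mB.
rewrite -nunu'// nug//; apply: eq_measure_integral => A mA _; exact: mumu'.
Qed.

(** No sign is assumed on [g]: since [+oo - oo = -oo], a finite integral
    already forces both parts of [g] to have finite integrals. *)
Lemma has_density_integrable {nu mu g} :
  has_density nu mu g -> mu.-integrable [set: T] (EFin \o g).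
Proof.
move=> [mg nug]; apply/integrableP; split; first exact/measurable_EFinP.
apply/abse_integralP => //; first exact/measurable_EFinP.
by rewrite -fin_num_abs -nug// fin_num_measure.
Qed.

Lemma has_density_dominates {nu mu g} : has_density nu mu g -> nu `<< mu.
Proof.
move=> [mg nug]; apply/null_content_dominatesP => A mA A0.
rewrite nug//; apply: null_set_integral => //.
exact/measurable_funTS/measurable_EFinP.
Qed.

(** Two integrable functions with equal integrals over all measurable sets agree almost everywhere.
    This gives access to the change of variables for Radon-Nikodym derivatives. *)
Lemma has_density_RN {nu mu g} : has_density nu mu g ->
  ae_eq mu setT (Radon_Nikodym_SigmaFinite.f nu mu) (EFin \o g).
Proof.
move=> nug; have numu := has_density_dominates nug; case: (nug) => mg nugE.
apply: integral_ae_eq => //.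
- exact: Radon_Nikodym_SigmaFinite.f_integrable.
- exact/measurable_EFinP.
- by move=> A _ mA; rewrite -Radon_Nikodym_SigmaFinite.f_integral// nugE.
Qed.

Lemma has_density_ge0_integral {nu mu g} (f : T -> \bar R) :
  has_density nu mu g -> measurable_fun setT f -> (forall x, 0 <= f x)%E ->
  (\int[nu]_x f x = \int[mu]_x (f x * (g x)%:E))%E.
Proof.
move=> nug mf f0; have numu := has_density_dominates nug.
rewrite -(Radon_Nikodym_SigmaFinite.change_of_variables numu)//.
apply: ae_eq_integral => //.
- apply: emeasurable_funM => //.
  by apply: measurable_int; exact: Radon_Nikodym_SigmaFinite.f_integrable.
- apply: emeasurable_funM => //; apply/measurable_EFinP; exact: nug.1.
- exact/ae_eqe_mul2l/has_density_RN.
Qed.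

Lemma has_density_ge0 {nu mu g} : has_density nu mu g ->
  {ae mu, forall x, 0 <= g x}.
Proof.
move=> nug; have numu := has_density_dominates nug.
apply: filterS (has_density_RN nug) => x /(_ I) /= gE.
by rewrite -lee_fin -gE Radon_Nikodym_SigmaFinite.f_ge0.
Qed.

(** Since [g] is nonnegative almost everywhere, the [mu]-integral of [|h * g|] is the [nu]-integral
    of [|h|], hence finite; the identity then follows from the Radon-Nikodym change of variables. *)
Lemma has_density_integral {nu mu g} h : has_density nu mu g ->
  nu.-integrable setT (EFin \o h) ->
  mu.-integrable setT (EFin \o (h \* g)) /\
  (\int[nu]_x (h x)%:E = \int[mu]_x (h x * g x)%:E)%E.
Proof.
move=> nug hi; have mg := nug.1.
have mh : measurable_fun setT h by apply/measurable_EFinP/(measurable_int _ hi).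
have hgi : mu.-integrable setT (EFin \o (h \* g)).
  apply/integrableP; split; first exact/measurable_EFinP/measurable_funM.
  have /integrableP[_] := hi.
  rewrite (has_density_ge0_integral _ nug)//; last first.
    by apply: measurableT_comp => //; exact/measurable_EFinP.
  apply: le_lt_trans; rewrite le_eqVlt; apply/orP; left; apply/eqP.
  apply: ae_eq_integral => //.
  - apply: measurableT_comp => //; exact/measurable_EFinP/measurable_funM.
  - apply: emeasurable_funM; last exact/measurable_EFinP.
    by apply: measurableT_comp => //; exact/measurable_EFinP.
  - apply: filterS (has_density_ge0 nug) => x g0 _ /=.
    by rewrite normrM EFinM (ger0_norm g0).
split=> //.
have numu := has_density_dominates nug.
rewrite -(Radon_Nikodym_change_of_variables numu)//.
apply: ae_eq_integral => //.
- by apply: emeasurable_funM => //; exact: measurable_int hi.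
- exact: measurable_int hgi.
- have /ae_eqe_mul2l : ae_eq mu setT ('d (charge_of_finite_measure nu) '/d mu)
      (EFin \o g).
    apply: ae_eq_trans (has_density_RN nug).
    exact/ae_eq_sym/ae_eq_Radon_Nikodym_SigmaFinite.
  exact.
Qed.

(** Chain rule for densities: it turns P(Y=1 | A=a, X) and P(A=a | X) into the density of a cell
    with respect to the law of X. *)
Lemma has_density_trans {nu mu} {la : {finite_measure set T -> \bar R}} {g h} :
  has_density nu mu g -> has_density mu la h -> has_density nu la (g \* h).
Proof.
move=> nug muh; have [mg nugE] := nug; have [mh _] := muh.
split; first exact: measurable_funM.
move=> B mB; rewrite nugE//.
(* The restriction to [B] is moved into the integrand, so that [has_density_integral] applies over
   the whole space. *)
have giB : mu.-integrable setT (EFin \o (fun x => g x * \1_B x)).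
  apply: le_integrable (has_density_integrable nug) => //.
    by apply/measurable_EFinP/measurable_funM => //; exact: measurable_indic.
  move=> x _ /=; rewrite lee_fin normrM ler_piMr// indicE.
  by case: (_ \in _); rewrite ?normr1 ?normr0.
have [_ E] := has_density_integral _ muh giB.
rewrite [LHS]integral_mkcond [RHS]integral_mkcond.
transitivity (\int[mu]_x (g x * \1_B x)%:E)%E.
  apply: eq_integral => x _; rewrite patchE indicE.
  by case: ifPn => _; rewrite ?mulr1 ?mulr0.
rewrite E; apply: eq_integral => x _; rewrite patchE indicE /=.
by case: ifPn => _; rewrite ?mulr1 ?mulr0 ?mul0r.
Qed.

Lemma has_density_compl {nu nu' mu g} :
  (forall B, measurable B -> (nu B + nu' B = mu B)%E) ->
  has_density nu mu g -> has_density nu' mu (fun x => 1 - g x).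
Proof.
move=> nunu' nug; have [mg nugE] := nug; split; first exact: measurable_funB.
move=> B mB; under eq_integral do rewrite EFinB.
have gB := integrableS measurableT mB (@subsetT _ B) (has_density_integrable nug).
rewrite integralB//; last first.
  apply: (integrableS measurableT) => //.
  exact: finite_measure_integrable_cst.
rewrite -nugE// integral_cst// mul1e -[X in (X - _)%E](nunu' _ mB).
by rewrite [X in (X - _)%E]addeC addeK// fin_num_measure.
Qed.

End density.

(** * Laws of X restricted to label events; risk and positive rates as integrals *)

Section label_events.
Context {d : measure_display} {T : measurableType d} {R : realType}.
Local Notation triple := (T * bool * bool)%type.
Implicit Types (P Q : probability triple R) (S : set (bool * bool)).

(** Indexing events by sets of label pairs treats conditions on A, on Y and on both uniformly;
    unions and intersections of events become those of label sets. *)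
Definition label_event S : set triple := [set z | S (tA z, tY z)].

Lemma measurable_label_event S : measurable (label_event S).
Proof.
have mA : measurable_fun [set: triple] (@tA d T).
  exact: (measurableT_comp measurable_snd measurable_fst).
have mY : measurable_fun [set: triple] (@tY d T) by exact: measurable_snd.
have -> : label_event S = \bigcup_(u in S)
    ([set z | tA z = u.1] `&` [set z | tY z = u.2]).
  apply/seteqP; split=> [z Sz|z [[a y] Say [/= Az Yz]]]; last first.
    by rewrite /label_event /= Az Yz.
  by exists (tA z, tY z).
apply: fin_bigcup_measurable => // u _; apply: measurableI.
- by rewrite -[X in measurable X]setTI; exact: (mA measurableT [set u.1]).
- by rewrite -[X in measurable X]setTI; exact: (mY measurableT [set u.2]).
Qed.

Lemma measurable_preimage_tX {B : set T} :
  measurable B -> measurable (tX @^-1` B : set triple).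
Proof.
move=> mB; rewrite -[X in measurable X]setTI.
exact: (measurable_tX measurableT).
Qed.

Definition sublaw P S (B : set T) : \bar R :=
  P (tX @^-1` B `&` label_event S).

Section sublaw_measure.
Variables (P : probability triple R) (S : set (bool * bool)).
Let sublaw0 : sublaw P S set0 = 0%E.
Proof. by rewrite /sublaw preimage_set0 set0I measure0. Qed.

Let sublaw_ge0 B : (0 <= sublaw P S B)%E. Proof. exact: measure_ge0. Qed.

Let sublaw_sigma_additive : semi_sigma_additive (sublaw P S).
Proof.
move=> F mF tF mUF; rewrite /sublaw preimage_bigcup setI_bigcupl.
apply: measure_semi_sigma_additive.
- move=> n; apply: measurableI; last exact: measurable_label_event.
  exact: measurable_preimage_tX.
- apply/trivIsetP => i j _ _ ij; rewrite setIACA setIid -preimage_setI.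
  by move/trivIsetP : tF => ->//; rewrite preimage_set0 set0I.
- rewrite -setI_bigcupl -preimage_bigcup; apply: measurableI.
    exact: measurable_preimage_tX.
  exact: measurable_label_event.
Qed.

HB.instance Definition _ := isMeasure.Build _ _ _ (sublaw P S)
  sublaw0 sublaw_ge0 sublaw_sigma_additive.

Let sublaw_fin : fin_num_fun (sublaw P S).
Proof.
move=> B mB; rewrite /sublaw fin_num_measure//.
apply: measurableI; first exact: measurable_preimage_tX.
exact: measurable_label_event.
Qed.

HB.instance Definition _ :=
  @Measure_isFinite.Build _ _ _ (sublaw P S) sublaw_fin.

Let ge0_integral_sublaw (f : T -> \bar R) (B : set T) : measurable B ->
  measurable_fun setT f -> (forall x, 0 <= f x)%E ->
  (\int[sublaw P S]_(x in B) f x =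
   \int[P]_(z in tX @^-1` B `&` label_event S) f (tX z))%E.
Proof.
move=> mB mf f0.
have mLE := measurable_label_event S.
have mXB := measurable_preimage_tX mB.
have mfX : measurable_fun setT (f \o @tX d T).
  by apply: measurableT_comp => //; exact: measurable_tX.
(* The sublaw is the image under [tX] of P restricted to the label event; this restriction does not
   charge the complement, so the domain can be cut down to the event. *)
transitivity (\int[mrestr P mLE]_(z in tX @^-1` B) (f \o @tX d T) z)%E.
  rewrite -(ge0_integral_pushforward measurable_tX)//.
  exact: measurable_funTS.
rewrite (@ge0_negligible_integral _ _ _ _ _ (~` label_event S))//; last 4 first.
- exact: measurableC.
- exact: measurable_funTS.
- by move=> z _; exact: f0.
- by rewrite /= /mrestr setICl measure0.
rewrite setDE setCK; apply: eq_measure_integral => A mA AS.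
by rewrite /= /mrestr setIidl// => z /AS[].
Qed.

Lemma integral_sublaw (f : T -> \bar R) (B : set T) : measurable B ->
  measurable_fun setT f ->
  (\int[sublaw P S]_(x in B) f x =
   \int[P]_(z in tX @^-1` B `&` label_event S) f (tX z))%E.
Proof.
move=> mB mf; rewrite integralE [RHS]integralE.
congr (_ - _)%E.
- rewrite ge0_integral_sublaw//; last exact: measurable_funepos.
  by apply: eq_integral => z _; rewrite !funeposE.
- rewrite ge0_integral_sublaw//; last exact: measurable_funeneg.
  by apply: eq_integral => z _; rewrite !funenegE.
Qed.

End sublaw_measure.

Lemma lawXE P B : lawX P B = sublaw P setT B.
Proof. by rewrite /sublaw setIT. Qed.

Lemma sublawU P S S' B : measurable B -> S `&` S' = set0 ->
  sublaw P (S `|` S') B = (sublaw P S B + sublaw P S' B)%E.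
Proof.
move=> mB SS'; have mXB := measurable_preimage_tX mB.
rewrite /sublaw -measureU ?setIUr//;
  try by apply: measurableI => //; exact: measurable_label_event.
apply/seteqP; split=> // z [[_ Sz] [_ S'z]].
by have : set0 (tA z, tY z) by rewrite -SS'.
Qed.

Lemma bounded_integrable (mu : {finite_measure set T -> \bar R})
    (f : T -> R) (M : R) :
  measurable_fun setT f -> (forall x, `|f x| <= M) ->
  mu.-integrable setT (EFin \o f).
Proof.
move=> mf fM.
have := finite_measure_integrable_cst mu M measurableT; apply: le_integrable => //.
  exact/measurable_EFinP.
by move=> x _ /=; rewrite lee_fin (le_trans (fM x)) ?ler_norm.
Qed.

Lemma classifier_integrable (mu : {finite_measure set T -> \bar R}) (f : T -> R) :
  is_classifier f -> mu.-integrable setT (EFin \o f).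
Proof.
move=> [mf f01]; apply: (@bounded_integrable _ _ 1) => // x.
by have /andP[f0 f1] := f01 x; rewrite ger0_norm.
Qed.

Lemma Rintegral_sublawU P S S' (f : T -> R) : is_classifier f ->
  S `&` S' = set0 ->
  \int[sublaw P (S `|` S')]_x f x =
  \int[sublaw P S]_x f x + \int[sublaw P S']_x f x.
Proof.
move=> cf SS'; rewrite /Rintegral -fineD; last 2 first.
- by apply: integrable_fin_num => //; exact: classifier_integrable.
- by apply: integrable_fin_num => //; exact: classifier_integrable.
congr fine; rewrite -integral_measure_add//; last 2 first.
- exact: classifier_integrable.
- exact: classifier_integrable.
apply: eq_measure_integral => A mA _.
transitivity (sublaw P S A + sublaw P S' A)%E; first exact: sublawU.
exact/esym/measure_addE.
Qed.

(** Integrating out the Bernoulli prediction: a triple whose labels admit the outcome 1 contributes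
    [f], one whose labels admit the outcome 0 contributes [1 - f]. *)
Lemma joint_law_sublaw P (f : T -> R) (W : bool * bool -> set bool) :
  is_classifier f ->
  joint_law P f [set u | W (tA u.1, tY u.1) u.2] =
  (\int[sublaw P [set v | W v true]]_x (f x)%:E +
   \int[sublaw P [set v | W v false]]_x (1 - f x)%:E)%E.
Proof.
move=> [mf f01].
have mrestrX S (g : T -> \bar R) : measurable_fun setT g ->
    measurable_fun setT ((fun z : triple => g (tX z)) \_ (label_event S)).
  move=> mg; have mgX : measurable_fun setT (fun z : triple => g (tX z)).
    by apply: (measurableT_comp mg); exact: measurable_tX.
  exact: (measurable_restrictT _ (measurable_label_event S)).1
    (measurable_funTS mgX).
have msub : measurable_fun setT (fun x => (1 - f x)%:E).
  by apply/measurable_EFinP; exact: measurable_funB.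
rewrite !integral_sublaw//; last exact/measurable_EFinP.
rewrite !preimage_setT !setTI integral_mkcond [X in (_ + X)%E]integral_mkcond.
rewrite -ge0_integralD//.
- apply: eq_integral => z _.
  rewrite (bernoulli_probE (f01 _)) !patchE.
  rewrite !diracE /unstable.onem.
  have inE' b : (b \in xsection [set u | W (tA u.1, tY u.1) u.2] z) =
      (z \in label_event [set v | W v b]).
    by apply/idP/idP; rewrite !inE /xsection /= ?inE.
  by rewrite !inE'; do 2 case: ifP => _; rewrite ?mule1 ?mule0.
- move=> z _; rewrite patchE; case: ifP => // _; rewrite lee_fin.
  by case/andP: (f01 (tX z)).
- by apply: (mrestrX _ (EFin \o f)); exact/measurable_EFinP.
- move=> z _; rewrite patchE; case: ifP => // _; rewrite lee_fin subr_ge0.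
  by case/andP: (f01 (tX z)).
- exact: mrestrX msub.
Qed.

Lemma Rintegral_sublaw_onem P S (f : T -> R) : is_classifier f ->
  \int[sublaw P S]_x (1 - f x) = fine (P (label_event S)) - \int[sublaw P S]_x f x.
Proof.
move=> cf; have -> : P (label_event S) = sublaw P S setT.
  by rewrite /sublaw preimage_setT setTI.
rewrite RintegralB//.
- by rewrite Rintegral_cst// mul1r.
- exact: finite_measure_integrable_cst.
- exact: classifier_integrable.
Qed.

(** The errors have mass [f] where Y = 0 and [1 - f] where Y = 1; splitting off the constant leaves
    an expression linear in [f]. *)
Lemma riskE P (f : T -> R) : is_classifier f ->
  risk P f = fine (P (label_event [set v | v.2 = true])) +
    (\int[sublaw P [set v | v.2 = false]]_x f x -
     \int[sublaw P [set v | v.2 = true]]_x f x).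
Proof.
move=> cf; rewrite /risk.
rewrite (joint_law_sublaw P f (fun v : bool * bool => [set b | v.2 <> b]) cf).
have mf := cf.1.
have -> : [set v : bool * bool | v.2 <> true] = [set v | v.2 = false].
  by apply/seteqP; split=> -[a []].
have -> : [set v : bool * bool | v.2 <> false] = [set v | v.2 = true].
  by apply/seteqP; split=> -[a []].
rewrite fineD; last 2 first.
- by apply: integrable_fin_num => //; exact: classifier_integrable.
- apply: integrable_fin_num => //; apply: (@bounded_integrable _ _ 1) => [|x].
    exact: measurable_funB.
  have /andP[f0 f1] := cf.2 x.
  by rewrite ger0_norm ?subr_ge0// lerBlDr lerDl.
have := Rintegral_sublaw_onem P [set v | v.2 = true] f cf.
rewrite /Rintegral => ->; ring.
Qed.

Lemma positive_rateE P S (f : T -> R) : is_classifier f ->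
  positive_rate P f (label_event S) =
  \int[sublaw P S]_x f x / fine (P (label_event S)).
Proof.
move=> cf; rewrite /positive_rate; congr (_ / _).
have := joint_law_sublaw P f (fun v : bool * bool => [set b | b = true /\ S v]) cf.
rewrite /= => ->.
have -> : [set v | true = true /\ S v] = S.
  by apply/seteqP; split=> [v []|v Sv].
have -> : [set v | false = true /\ S v] = set0.
  by apply/seteqP; split=> [v []|v Sv].
rewrite [X in (_ + X)%E](_ : _ = 0%E) ?adde0//.
rewrite integral_sublaw//; last first.
  by apply/measurable_EFinP; apply: measurable_funB => //; exact: cf.1.
rewrite (_ : _ `&` _ = set0) ?integral_set0//.
by apply/seteqP; split=> // z [].
Qed.

End label_events.

(** * Effect of the reweighting on each cell *)

Section reweighting.
Context {d : measure_display} {T : measurableType d} {R : realType}.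
Local Notation triple := (T * bool * bool)%type.
Implicit Types (P Q : probability triple R) (f : T -> R).

Lemma pAYE P a y : pAY P a y = fine (P (label_event [set (a, y)])).
Proof.
congr (fine (P _)); apply/seteqP; split=> z /=.
  by move=> [Aa Yy]; rewrite /label_event /= Aa Yy.
by rewrite /label_event /= => -[].
Qed.

Lemma reweighting_sublaw {D : disparity} {P} {t} {Q} :
  (forall a y, 0 < pAY P a y) -> is_reweighting D P t Q ->
  exists2 c : R, 0 < c & forall a y f, is_classifier f ->
    \int[sublaw Q [set (a, y)]]_x f x =
    c * reweight D P t a y * \int[sublaw P [set (a, y)]]_x f x.
Proof.
move=> p0 [[c c0 qE] qX]; exists c => // a y f cf.
set k := c * reweight D P t a y.
have q0 : 0 <= pAY Q a y by rewrite fine_ge0.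
(* The factor is a quotient of two cell probabilities, so it is nonnegative whatever the sign of
   [t]. *)
have kE : k = pAY Q a y / pAY P a y by rewrite qE mulfK// gt_eqF.
have k0 : 0 <= k by rewrite kE divr_ge0// ltW.
have sQ B : measurable B ->
    sublaw Q [set (a, y)] B = (k%:E * sublaw P [set (a, y)] B)%E.
  move=> mB.
  have finE (M : probability triple R) : sublaw M [set (a, y)] B =
      (fine (M [set z | [/\ B (tX z), tA z = a & tY z = y]]))%:E.
    have -> : [set z : triple | [/\ B (tX z), tA z = a & tY z = y]] =
        tX @^-1` B `&` label_event [set (a, y)].
      apply/seteqP; split=> [z [Bz Aa Yy]|z [Bz [Aa Yy]]]; last by split.
      by split=> //; rewrite /label_event /= Aa Yy.
    by rewrite fineK// fin_num_measure//; apply: measurableI;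
      [exact: measurable_preimage_tX|exact: measurable_label_event].
  have [q_gt0|q_le0] := ltP 0 (pAY Q a y).
    have := qX a y q_gt0 B mB; rewrite /lawX_given => H.
    rewrite !finE -EFinM; congr EFin; rewrite kE.
    rewrite -[LHS](@divfK _ (pAY Q a y)) ?gt_eqF// H.
    by rewrite mulrC mulrA mulrAC.
  (* On a [Q]-null cell the conditional law is unconstrained, but the factor is 0 and the sublaw of
     [Q] vanishes as well. *)
  have qa0 : pAY Q a y = 0 by apply/eqP; rewrite eq_le q_le0.
  rewrite kE qa0 mul0r mul0e; apply/eqP; rewrite -measure_le0 /=.
  rewrite -[leRHS](_ : Q (label_event [set (a, y)]) = 0%E); last first.
    move: qa0; rewrite pAYE => /eqP; rewrite fine_eq0 ?fin_num_measure//.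
      by move/eqP.
    exact: measurable_label_event.
  apply: le_measure; rewrite ?inE.
  - apply: measurableI; first exact: measurable_preimage_tX.
    exact: measurable_label_event.
  - exact: measurable_label_event.
  - exact: subIsetr.
rewrite /Rintegral (_ : (\int[_]_x _)%E =
  (\int[mscale (NngNum k0) (sublaw P [set (a, y)])]_x (f x)%:E)%E); last first.
  by apply: eq_measure_integral => B mB _; exact: sQ.
have mf := cf.1.
rewrite ge0_integral_mscale//.
- rewrite fineM//; apply: integrable_fin_num => //; exact: classifier_integrable.
- exact/measurable_EFinP.
- by move=> x _; rewrite lee_fin; case/andP: (cf.2 x).
Qed.

End reweighting.

(** * The risk under the reweighted law as a Lagrangian *)

Section lagrangian.
Context {d : measure_display} {T : measurableType d} {R : realType}.
Local Notation triple := (T * bool * bool)%type.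
Implicit Types (P Q : probability triple R) (f : T -> R).

Lemma pA_gt0 {P} : (forall a y, 0 < pAY P a y) -> forall a, 0 < pA P a.
Proof.
move=> p0 a; apply: lt_le_trans (p0 a true) _.
have mS := @measurable_label_event d T.
apply: fine_le; rewrite ?fin_num_measure//.
- exact: (mS [set v | v.1 = a /\ v.2 = true]).
- exact: (mS [set v | v.1 = a]).
apply: le_measure; rewrite ?inE.
- exact: (mS [set v | v.1 = a /\ v.2 = true]).
- exact: (mS [set v | v.1 = a]).
- by move=> z [].
Qed.

Lemma Rintegral_sublaw_snd P y f : is_classifier f ->
  \int[sublaw P [set v | v.2 = y]]_x f x =
  \int[sublaw P [set (true, y)]]_x f x + \int[sublaw P [set (false, y)]]_x f x.
Proof.
move=> cf; rewrite -Rintegral_sublawU//.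
  congr (Rintegral (sublaw P _) _ _).
  by apply/seteqP; split=> [[[] b] /= ->|[a b] [[_ ->]|[_ ->]]]//; [left|right].
by apply/seteqP; split=> // v [-> []].
Qed.

Lemma Rintegral_sublaw_fst P a f : is_classifier f ->
  \int[sublaw P [set v | v.1 = a]]_x f x =
  \int[sublaw P [set (a, true)]]_x f x + \int[sublaw P [set (a, false)]]_x f x.
Proof.
move=> cf; rewrite -Rintegral_sublawU//.
  congr (Rintegral (sublaw P _) _ _).
  by apply/seteqP; split=> [[b []] /= ->|[b y] [[-> _]|[-> _]]]//; [left|right].
by apply/seteqP; split=> // v [-> []].
Qed.

Lemma positive_rate_DD P a f : is_classifier f ->
  positive_rate P f (dis_group DD a) =
  \int[sublaw P [set v | v.1 = a]]_x f x / pA P a.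
Proof. exact: positive_rateE P [set v | v.1 = a] f. Qed.

Lemma positive_rate_AY P a y f : is_classifier f ->
  positive_rate P f [set z | tA z = a /\ tY z = y] =
  \int[sublaw P [set (a, y)]]_x f x / pAY P a y.
Proof.
move=> cf; rewrite pAYE -positive_rateE//; congr positive_rate.
apply/seteqP; split=> z /=.
  by move=> [Aa Yy]; rewrite /label_event /= Aa Yy.
by rewrite /label_event /= => -[].
Qed.

(** The cell (a, y) enters the risk with sign 1-2y. Multiplied by this sign, the [t]-term of each
    weight becomes (2a-1) [t] over the group probability, so these terms add up to [t] times the
    disparity. *)
Lemma risk_reweighting {D} {P} {t} {Q} : (forall a y, 0 < pAY P a y) ->
  is_reweighting D P t Q ->
  exists2 c : R, 0 < c & exists K : R, forall f, is_classifier f ->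
    risk Q f = K + c * (risk P f + t * dis D P f).
Proof.
move=> p0 QP; have [c c0 JQ] := reweighting_sublaw p0 QP; exists c => //.
have pa := pA_gt0 p0.
exists (fine (Q (label_event [set v | v.2 = true])) -
  c * fine (P (label_event [set v | v.2 = true]))) => f cf.
have n0 a : pA P a != 0 by rewrite gt_eqF.
have n0' a y : pAY P a y != 0 by rewrite gt_eqF.
rewrite !riskE// !Rintegral_sublaw_snd// !JQ//.
rewrite /dis; clear QP JQ; case: D => /=.
- rewrite !positive_rate_DD// !Rintegral_sublaw_fst//; field.
  by rewrite !n0.
- by rewrite !positive_rate_AY//; field; rewrite !n0'.
- by rewrite !positive_rate_AY//; field; rewrite !n0'.
Qed.

End lagrangian.

(** * Conditional probabilities as densities *)

Section densities.
Context {d : measure_display} {T : measurableType d} {R : realType}.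
Local Notation triple := (T * bool * bool)%type.
Implicit Types (P : probability triple R) (f g : T -> R).

Lemma cond_prob_version_density {P S S'} {g} :
  cond_prob_version P (label_event S') (label_event S) g ->
  has_density (sublaw P (S' `&` S)) (sublaw P S) g.
Proof.
move=> [mg gE]; split=> // B mB.
rewrite integral_sublaw//; last exact/measurable_EFinP.
transitivity (P (label_event S' `&` (label_event S `&` tX @^-1` B))).
  by congr (P _); rewrite setIC -setIA.
by rewrite gE// setIC.
Qed.

(** A difference of normalized group integrals becomes one integral against a common measure; this
    is how the weighting functions arise. *)
Lemma density_combination {nu1 nu2 mu : {finite_measure set T -> \bar R}}
    {g1 g2 : T -> R} (c1 c2 : R) :
  has_density nu1 mu g1 -> has_density nu2 mu g2 ->
  mu.-integrable setT (EFin \o (fun x => g1 x / c1 - g2 x / c2)) /\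
  forall f, is_classifier f ->
    \int[nu1]_x f x / c1 - \int[nu2]_x f x / c2 =
    \int[mu]_x (f x * (g1 x / c1 - g2 x / c2)).
Proof.
move=> h1 h2; split.
  have := integrableB measurableT
    (integrableZr measurableT c1^-1 (has_density_integrable h1))
    (integrableZr measurableT c2^-1 (has_density_integrable h2)).
  by apply: eq_integrable.
move=> f cf.
have [i1 E1] := has_density_integral f h1 (classifier_integrable nu1 f cf).
have [i2 E2] := has_density_integral f h2 (classifier_integrable nu2 f cf).
rewrite /Rintegral E1 E2 -[fine _]/(Rintegral mu setT _).
rewrite -[X in _ - X / _]/(Rintegral mu setT _) -!RintegralZr// -RintegralB//.
- by apply: eq_Rintegral => x _; ring.
- exact: integrableZr i1.
- exact: integrableZr i2.
Qed.

End densities.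

(** * Pointwise minimization of the Lagrangian by threshold rules *)

Section threshold_rules.
Context {d : measure_display} {T : measurableType d} {R : realType}.
Variables (mu : {finite_measure set T -> \bar R}) (eta w : T -> R).
Hypotheses (eta_int : mu.-integrable setT (EFin \o eta))
  (w_int : mu.-integrable setT (EFin \o w)).
Hypothesis boundary0 : forall t, mu [set x | eta x = 2^-1 + t / 2 * w x] = 0%E.
Implicit Types (f : T -> R) (t : R).

Definition threshold_rule t : T -> R := \1_[set x | eta x > 2^-1 + t / 2 * w x].

(** The coefficient of [f x] in the Lagrangian: a minimizer takes the value 1 where it is negative
    and 0 where it is positive. Its zero set is the boundary set. *)
Let score t x : R := 1 - 2 * eta x + t * w x.

Let meta : measurable_fun setT eta.
Proof. exact/measurable_EFinP/measurable_int/eta_int. Qed.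

Let mw : measurable_fun setT w.
Proof. exact/measurable_EFinP/measurable_int/w_int. Qed.

Let mline {t} : measurable_fun setT (fun x => 2^-1 + t / 2 * w x).
Proof. by apply: measurable_funD => //; exact: measurable_funM. Qed.

Let threshold_ruleE t x : threshold_rule t x = (score t x < 0)%R%:R.
Proof.
rewrite /threshold_rule indicE; congr (_%:R); congr nat_of_bool.
apply/idP/idP; rewrite inE /score /=; lra.
Qed.

Lemma classifier_threshold_rule t : is_classifier (threshold_rule t).
Proof.
split=> [|x]; last by rewrite threshold_ruleE; case: ltP; rewrite ?lexx ler01.
apply: measurable_indic; rewrite -[X in measurable X]setTI.
have mtrue : measurable [set true] by [].
exact: (measurable_fun_ltr (@mline t) meta measurableT mtrue).
Qed.

Let score_neq0 t : {ae mu, forall x, score t x != 0}.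
Proof.
exists [set x | eta x = 2^-1 + t / 2 * w x]; split=> //.
  rewrite (_ : mkset _ = setT `&`
      (fun x => eta x == 2^-1 + t / 2 * w x) @^-1` [set true]).
    have mtrue : measurable [set true] by [].
    exact: (measurable_fun_eqr meta (@mline t) measurableT mtrue).
  by rewrite setTI; apply/seteqP; split=> x /eqP.
move=> x /= /negP; rewrite negbK /score => /eqP ?; lra.
Qed.

Let mul_integrable f (h : T -> R) : is_classifier f ->
  mu.-integrable setT (EFin \o h) ->
  mu.-integrable setT (EFin \o (fun x => f x * h x)).
Proof.
move=> [mf f01] ih; apply: le_integrable (ih) => //.
  apply/measurable_EFinP/measurable_funM => //.
  exact/measurable_EFinP/measurable_int/ih.
move=> x _ /=; rewrite lee_fin normrM.
have /andP[f0 f1] := f01 x.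
by rewrite (ger0_norm f0) ler_piMl.
Qed.

Let cost_int : mu.-integrable setT (EFin \o (fun x => 1 - 2 * eta x)).
Proof.
have := integrableB measurableT (finite_measure_integrable_cst mu 1 measurableT)
  (integrableZl measurableT 2 eta_int).
by apply: eq_integrable.
Qed.

Let score_int t : mu.-integrable setT (EFin \o score t).
Proof.
have := integrableD measurableT cost_int (integrableZl measurableT t w_int).
by apply: eq_integrable.
Qed.

(** With [w] the weight of a disparity, this is the risk plus [t] times the disparity, up to the
    constant P(Y=1). *)
Definition lagrangian t f : R :=
  \int[mu]_x (f x * (1 - 2 * eta x)) + t * \int[mu]_x (f x * w x).

Let lagrangianE t f : is_classifier f ->
  lagrangian t f = \int[mu]_x (f x * score t x).
Proof.
move=> cf; rewrite /lagrangian -RintegralZl//; last exact: mul_integrable.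
rewrite -RintegralD//.
- by apply: eq_Rintegral => x _; rewrite /score; ring.
- exact: mul_integrable.
- have := integrableZl measurableT t (mul_integrable _ _ cf w_int).
  by apply: eq_integrable.
Qed.

(** The pointwise excess of [f] over the threshold rule; it is nonnegative, and its integral is the
    excess of the Lagrangian. *)
Let gap t f x : R := (f x - threshold_rule t x) * score t x.

Let gap_ge0 t f x : is_classifier f -> 0 <= gap t f x.
Proof.
move=> [_ /(_ x)/andP[f0 f1]]; rewrite /gap threshold_ruleE.
case: ltP => s0 /=; first by rewrite mulr_le0 ?subr_le0// ltW.
by rewrite subr0 mulr_ge0.
Qed.

Let gap_int t f : is_classifier f -> mu.-integrable setT (EFin \o gap t f).
Proof.
move=> cf; have := integrableB measurableT (mul_integrable _ _ cf (score_int t))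
  (mul_integrable _ _ (classifier_threshold_rule t) (score_int t)).
by apply: eq_integrable => // x _; rewrite /= /gap mulrBl.
Qed.

Let lagrangian_gap t f : is_classifier f ->
  lagrangian t f = lagrangian t (threshold_rule t) + \int[mu]_x gap t f x.
Proof.
move=> cf; have ct := classifier_threshold_rule t.
rewrite !lagrangianE// -RintegralD//.
- by apply: eq_Rintegral => x _; rewrite /gap; ring.
- exact: mul_integrable.
- exact: gap_int.
Qed.

Lemma threshold_rule_min t f : is_classifier f ->
  lagrangian t (threshold_rule t) <= lagrangian t f.
Proof.
move=> cf; rewrite [leRHS]lagrangian_gap// lerDl; apply: Rintegral_ge0 => x _.
exact: gap_ge0.
Qed.

(** A minimizer has a nonnegative gap of integral zero, so the gap vanishes almost everywhere. Off
    the null boundary the score is nonzero, so [f] equals the threshold rule there. *)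
Lemma lagrangian_min_Rintegral t f : is_classifier f ->
  lagrangian t f <= lagrangian t (threshold_rule t) ->
  \int[mu]_x (f x * w x) = \int[mu]_x (threshold_rule t x * w x).
Proof.
move=> cf; rewrite lagrangian_gap// gerDl => gap_le0.
have gap0 : (\int[mu]_x `|(gap t f x)%:E| = 0)%E.
  under eq_integral do rewrite gee0_abs ?lee_fin ?gap_ge0//.
  rewrite -(fineK (integrable_fin_num measurableT (gap_int t f cf))).
  congr EFin; apply/eqP; rewrite eq_le gap_le0/=.
  by apply: Rintegral_ge0 => x _; exact: gap_ge0.
have mgap := measurable_int _ (gap_int t f cf).
have gap_ae := (ae_eq_integral_abs mu measurableT mgap).1 gap0.
have mwE f' : is_classifier f' -> measurable_fun setT (fun x => (f' x * w x)%:E).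
  by move=> cf'; exact: measurable_int (mul_integrable _ _ cf' w_int).
congr fine; apply: ae_eq_integral => //.
- exact: mwE.
- exact: mwE (classifier_threshold_rule t).
apply: filterS2 gap_ae (score_neq0 t) => x /(_ I) /= [] /eqP.
by rewrite mulf_eq0 subr_eq0 => /orP[/eqP -> //|/eqP ->]; rewrite eqxx.
Qed.

(** Adding the optimality of each rule at its own multiplier, tested against the other rule, gives
    [(t - s) * (D t - D s) <= 0], with [D] the integral in question. *)
Lemma threshold_rule_antitone s t : s <= t ->
  \int[mu]_x (threshold_rule t x * w x) <= \int[mu]_x (threshold_rule s x * w x).
Proof.
rewrite le_eqVlt => /orP[/eqP ->//|st].
have := threshold_rule_min s _ (classifier_threshold_rule t).
have := threshold_rule_min t _ (classifier_threshold_rule s).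
rewrite /lagrangian; nra.
Qed.

(** Dominated convergence with bound [|w|]: where the score at [t] is nonzero, its sign, and with it
    the rule, is constant for nearby multipliers. *)
Lemma continuous_threshold_rule :
  continuous (fun t => \int[mu]_x (threshold_rule t x * w x)).
Proof.
move=> t; apply/(@cvg_nbhsP _ R^o) => u ut.
have ci s := mul_integrable _ _ (classifier_threshold_rule s) w_int.
apply: fine_cvg; rewrite fineK; last by apply: integrable_fin_num => //; exact: ci.
have [] // := @dominated_convergence _ _ _ mu setT measurableT
  (fun n x => (threshold_rule (u n) x * w x)%:E)
  (fun x => (threshold_rule t x * w x)%:E) (fun x => `|w x|%:E).
- by move=> n; exact: measurable_int (ci (u n)).
- exact: measurable_int (ci t).
- apply: filterS (score_neq0 t) => x sx _; apply: cvg_near_cst.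
  have su : score (u n) x @[n --> \oo] --> score t x.
    apply: cvgD; first exact: cvg_cst.
    exact: cvgM ut (cvg_cst (w x)).
  case: (ltgtP (score t x) 0) sx => // s0 _.
  + apply: filterS (cvgr_lt (score t x) su 0 s0) => n sn.
    by rewrite !threshold_ruleE s0 sn.
  + apply: filterS (cvgr_gt (score t x) su 0 s0) => n sn.
    by rewrite !threshold_ruleE !ltNge !ltW.
- exact: integrable_abse w_int.
- apply: aeW => x n _; rewrite /= lee_fin normrM.
  have /andP[f0 f1] := (classifier_threshold_rule (u n)).2 x.
  by rewrite (ger0_norm f0) ler_piMl.
Qed.

(** The rule [1 - threshold_rule 0] has disparity [- D 0] since [w] has mean [0];
    for a multiplier [t] large enough in the direction of [D 0], comparing
    Lagrangians with it forces [D t] to have the sign opposite to [D 0]. *)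
Lemma threshold_rule_crossing : \int[mu]_x w x = 0 ->
  let D t := \int[mu]_x (threshold_rule t x * w x) in
  D 0 != 0 -> exists t, D 0 * D t <= 0.
Proof.
move=> w0 D D0; pose g x := 1 - threshold_rule 0 x.
have c0 := classifier_threshold_rule 0.
have cg : is_classifier g.
  split=> [|x]; first by apply: measurable_funB => //; exact: c0.1.
  by have /andP[? ?] := c0.2 x; rewrite /g subr_ge0 lerBlDr lerDl; apply/andP.
have gw : \int[mu]_x (g x * w x) = - D 0.
  transitivity (\int[mu]_x w x - D 0); last by rewrite w0 sub0r.
  rewrite /D -(RintegralB measurableT w_int (mul_integrable _ _ c0 w_int)).
  by apply: eq_Rintegral => x _; rewrite /g mulrBl mul1r.
pose A f := \int[mu]_x (f x * (1 - 2 * eta x)).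
have A0 f : is_classifier f -> A (threshold_rule 0) <= A f.
  move=> cf; have := threshold_rule_min 0 f cf.
  by rewrite /lagrangian !mul0r !addr0.
(* Chosen so that the Lagrangian of [g] at [t] is [A (threshold_rule 0) - D 0 ^+ 2]; as [A] is least
   at [threshold_rule 0], optimality at [t] forces [t * D t < 0], while [t * D 0 > 0]. *)
pose t := (A g - A (threshold_rule 0)) / D 0 + D 0; exists t.
have ct := classifier_threshold_rule t.
have Ag := A0 g cg; have At := A0 _ ct.
have tD0 : t * D 0 = (A g - A (threshold_rule 0)) + D 0 ^+ 2.
  by rewrite /t mulrDl divfK.
have D02 : 0 < D 0 ^+ 2 by rewrite exprn_even_gt0.
have : lagrangian t (threshold_rule t) <= lagrangian t g.
  exact: threshold_rule_min.
rewrite /lagrangian gw -/(A _) -/(A g) -/(D t) => H.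
have tDt : t * D t < 0 by move: H; rewrite mulrN tD0; lra.
have tD0_gt0 : 0 < t * D 0 by rewrite tD0; lra.
rewrite leNgt; apply/negP => DD.
have : 0 < t ^+ 2 * (D 0 * D t).
  by rewrite mulr_gt0// lt0r sqr_ge0 andbT; apply: contraTN tDt => /eqP t2;
    move: t2 => /eqP; rewrite sqrf_eq0 => /eqP ->; rewrite mul0r ltxx.
rewrite (_ : _ * _ = (t * D t) * (t * D 0)); last by ring.
by rewrite pmulr_lgt0// ltNge ltW.
Qed.

End threshold_rules.

(** * The multiplier of least absolute value and complementary slackness *)

Section least_multiplier.
Context {R : realType}.
Implicit Types (D : R -> R) (delta t : R).

(** As [D] is antitone and [D 0] exceeds [delta], feasible multipliers are positive, and the least
    one is the infimum of the set where [D] is at most [delta]. *)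
Lemma crossing_argmin {D} {delta} : continuous D ->
  (forall s t, s <= t -> D t <= D s) -> 0 <= delta -> delta < D 0 ->
  (exists t, D t <= 0) ->
  argmin [set t | `|D t| <= delta] (fun t => `|t|) !=set0.
Proof.
move=> Dc Dn d0 dD0 [t1 Dt1].
have lt0 s : D s <= delta -> 0 < s.
  by move=> Ds; rewrite ltNge; apply/negP => /Dn; rewrite leNgt (le_lt_trans Ds).
have t1_gt0 : 0 < t1 by apply: lt0; rewrite (le_trans Dt1).
have [s s01 Ds] : exists2 s, s \in `[0, t1] & D s = delta.
  apply: IVT; first exact: ltW.
    exact: continuous_subspaceT.
  by rewrite ge_min le_max (ltW dD0) (le_trans Dt1 d0) orbT.
pose A := [set u | D u <= delta].
(* The point [s] shows that [A] is nonempty; it also yields [delta <= D (inf A)] by monotonicity. *)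
have A0 : has_inf A.
  split; first by exists s; rewrite /A /= Ds.
  by exists 0 => u /lt0/ltW.
have infA u : A u -> inf A <= u by move=> Au; apply: ge_inf => //; exact: A0.2.
(* Otherwise, by continuity, [D] would exceed [delta] around the infimum, where there are points of
   [A]. *)
have DA : D (inf A) <= delta.
  rewrite leNgt; apply/negP => dlt.
  have : \forall u \near inf A, delta < D u.
    exact: cvgr_gt (D (inf A)) (Dc (inf A)) delta dlt.
  move=> /nbhs_ballP[e /= e0 He].
  have [a Aa ae] := inf_adherent e0 A0.
  have : delta < D a.
    apply: He; rewrite /ball /= ltr_distlC.
    by have := infA a Aa; move: ae => *; apply/andP; split; lra.
  by rewrite ltNge Aa.
have DA' : delta <= D (inf A) by rewrite -Ds; apply/Dn/infA; rewrite /A /= Ds.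
exists (inf A); split=> /=.
  by rewrite ger0_norm ?(le_trans d0).
move=> v Dv; have Av : A v by apply: le_trans Dv; exact: ler_norm.
by rewrite !gtr0_norm ?lt0// infA.
Qed.

Lemma least_multiplier D delta : continuous D ->
  (forall s t, s <= t -> D t <= D s) -> 0 <= delta ->
  (D 0 != 0 -> exists t, D 0 * D t <= 0) ->
  let t := xget 0 (argmin [set t | `|D t| <= delta] (fun t => `|t|)) in
  `|D t| <= delta /\ t * D t = `|t| * delta.
Proof.
move=> Dc Dn d0 Dx t.
(* The reflection [u |-> - D (- u)] is again continuous and antitone, and reduces the case of
   negative [D 0] to that of positive [D 0]. *)
have Dr_c : continuous (fun u => - D (- u)).
  move=> u; apply: cvgN; apply: continuous_comp; first exact: opp_continuous.
  exact: Dc.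
have Dr_n s u : s <= u -> - D (- u) <= - D (- s).
  by move=> su; rewrite lerN2; apply: Dn; rewrite lerN2.
have [u0 Au0] : argmin [set t | `|D t| <= delta] (fun t => `|t|) !=set0.
  have [D0|D0] := leP `|D 0| delta.
    by exists 0; split=> // v _; rewrite normr0.
  have D00 : D 0 != 0 by rewrite -normr_gt0 (le_lt_trans d0).
  have [v Dv] := Dx D00.
  have [Dpos|Dneg] := ltP 0 (D 0).
    apply: crossing_argmin => //; first by rewrite gtr0_norm in D0.
    by exists v; rewrite pmulr_rle0 in Dv.
  have {}Dneg : D 0 < 0 by rewrite lt_neqAle D00.
  have [||u [Du umin]] := crossing_argmin Dr_c Dr_n d0.
  - by rewrite oppr0 -ltr0_norm.
  - by exists (- v); rewrite opprK oppr_le0; rewrite nmulr_rle0 in Dv.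
  exists (- u); split=> /= [|v' Dv']; first by rewrite -normrN.
  by rewrite normrN -(normrN v'); apply: umin => /=; rewrite opprK normrN.
have [/= Dt tmin] : argmin [set t | `|D t| <= delta] (fun t => `|t|) t.
  exact: xgetI Au0.
split=> //.
have IVT' (a b y : R) : a <= b -> D b <= y <= D a ->
    exists2 s, a <= s <= b & D s = y.
  move=> ab /andP[yb ya]; have [||s sab <-] := @IVT R D a b y ab.
  - exact: continuous_subspaceT.
  - by rewrite ge_min le_max yb ya !orbT.
  by exists s => //; move: sab; rewrite in_itv.
(* By minimality, every multiplier strictly closer to 0 is infeasible, in particular 0 itself when
   [t] is nonzero. *)
have nf s : `|s| < `|t| -> delta < `|D s|.
  by move=> st; rewrite ltNge; apply/negP => /tmin; rewrite leNgt st.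
have [t0|t0|->] := ltgtP t 0; last by rewrite normr0 !mul0r.
(* Here [D 0 < - delta]. A point [s] between [t] and 0 with [D s = - delta] is feasible, so
   minimality gives [s = t] and the constraint is active. The positive case is symmetric. *)
- have D0 := Dn _ _ (ltW t0).
  have := nf 0; rewrite normr0 normr_gt0 lt_eqF// => /(_ isT).
  move: Dt; rewrite ler_norml ltr_normr => /andP[Dt1 Dt2] /orP[|D0lt]; first by lra.
  have [||s /andP[ts s0] Ds] := IVT' t 0 (- delta);
    [exact: ltW|by apply/andP; split; lra|].
  have : `|t| <= `|s| by apply: tmin; rewrite /= Ds normrN ger0_norm.
  rewrite (ltr0_norm t0) (ler0_norm s0) lerN2 => st.
  have -> : D t = - delta by rewrite -Ds; congr D; lra.
  by rewrite mulrN mulNr.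
- have D0 := Dn _ _ (ltW t0).
  have := nf 0; rewrite normr0 normr_gt0 gt_eqF// => /(_ isT).
  move: Dt; rewrite ler_norml ltr_normr => /andP[Dt1 Dt2] /orP[D0lt|]; last by lra.
  have [||s /andP[s0 st] Ds] := IVT' 0 t delta;
    [exact: ltW|by apply/andP; split; lra|].
  have : `|t| <= `|s| by apply: tmin; rewrite /= Ds ger0_norm.
  rewrite (gtr0_norm t0) (ger0_norm s0) => ts.
  by have -> : D t = delta by rewrite -Ds; congr D; lra.
Qed.

End least_multiplier.

(** * Disparity and risk as integrals against the law of X *)

Section fairness_integrals.
Context {d : measure_display} {T : measurableType d} {R : realType}.
Local Notation triple := (T * bool * bool)%type.
Variables (P : probability triple R) (etaY etaA : T -> R) (etaYA : bool -> T -> R).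
Hypotheses (p_gt0 : forall a y, 0 < pAY P a y)
  (etaYP : cond_prob_version P [set z | tY z = true] setT etaY)
  (etaAP : cond_prob_version P [set z | tA z = true] setT etaA)
  (etaYAP : forall a,
     cond_prob_version P [set z | tY z = true] [set z | tA z = a] (etaYA a)).

Let density_snd_true : has_density (sublaw P [set v | v.2 = true]) (lawX P) etaY.
Proof.
have := @cond_prob_version_density _ _ _ P setT [set v | v.2 = true] _ etaYP.
apply: eq_has_density => B mB; first by rewrite setIT.
exact: esym (lawXE P B).
Qed.

Let density_fst_true : has_density (sublaw P [set v | v.1 = true]) (lawX P) etaA.
Proof.
have := @cond_prob_version_density _ _ _ P setT [set v | v.1 = true] _ etaAP.
apply: eq_has_density => B mB; first by rewrite setIT.
exact: esym (lawXE P B).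
Qed.

Let density_snd_false :
  has_density (sublaw P [set v | v.2 = false]) (lawX P) (fun x => 1 - etaY x).
Proof.
apply: has_density_compl density_snd_true => B mB.
rewrite -sublawU//; last by apply/seteqP; split=> // -[a []] [].
transitivity (sublaw P setT B); last exact/esym/lawXE.
congr (sublaw P _ B).
by apply/seteqP; split=> // -[a []] _; [left|right].
Qed.

Let density_fst_false :
  has_density (sublaw P [set v | v.1 = false]) (lawX P) (fun x => 1 - etaA x).
Proof.
apply: has_density_compl density_fst_true => B mB.
rewrite -sublawU//; last by apply/seteqP; split=> // -[[] y] [].
transitivity (sublaw P setT B); last exact/esym/lawXE.
congr (sublaw P _ B).
by apply/seteqP; split=> // -[[] y] _; [left|right].
Qed.

Let density_true a :
  has_density (sublaw P [set (a, true)]) (sublaw P [set v | v.1 = a]) (etaYA a).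
Proof.
have := @cond_prob_version_density _ _ _ P [set v | v.1 = a] [set v | v.2 = true] _
  (etaYAP a).
apply: eq_has_density => // B mB; congr (sublaw P _ B).
by apply/seteqP; split=> [[b y] [/= -> ->]|_ ->].
Qed.

Let density_false a :
  has_density (sublaw P [set (a, false)]) (sublaw P [set v | v.1 = a])
    (fun x => 1 - etaYA a x).
Proof.
apply: has_density_compl (density_true a) => B mB.
rewrite -sublawU//; last by apply/seteqP; split=> // v [-> []].
congr (sublaw P _ B).
by apply/seteqP; split=> [v [->|->]|[b []] /= ->]//; [left|right].
Qed.

Lemma dis_weight D : let w := weight D P etaA etaYA in
  (lawX P).-integrable setT (EFin \o w) /\
  forall f, is_classifier f -> dis D P f = \int[lawX P]_x (f x * w x).
Proof.
case: D => /=.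
- have [iw wE] := density_combination (pA P true) (pA P false)
    density_fst_true density_fst_false.
  by split=> // f cf; rewrite -wE// /dis !positive_rate_DD.
(* The density of a cell with respect to the law of X is obtained through the law of X on A = a. *)
- have [iw wE] := density_combination (pAY P true true) (pAY P false true)
    (has_density_trans (density_true true) density_fst_true)
    (has_density_trans (density_true false) density_fst_false).
  by split=> // f cf; rewrite -wE// /dis !positive_rate_AY.
- have [iw wE] := density_combination (pAY P true false) (pAY P false false)
    (has_density_trans (density_false true) density_fst_true)
    (has_density_trans (density_false false) density_fst_false).
  by split=> // f cf; rewrite -wE// /dis !positive_rate_AY.
Qed.

Lemma etaY_integrable : (lawX P).-integrable setT (EFin \o etaY).
Proof. exact: has_density_integrable density_snd_true. Qed.

Lemma risk_etaY f : is_classifier f ->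
  risk P f = fine (P (label_event [set v | v.2 = true])) +
    \int[lawX P]_x (f x * (1 - 2 * etaY x)).
Proof.
move=> cf; rewrite riskE//; congr (_ + _).
have [_ E] := density_combination 1 1 density_snd_false density_snd_true.
have := E f cf; rewrite !divr1 => ->.
by apply: eq_Rintegral => x _; rewrite !divr1; ring.
Qed.

(** The constant classifier 1 has positive rate 1 in every group, hence disparity 0. *)
Lemma Rintegral_weight D : \int[lawX P]_x weight D P etaA etaYA x = 0.
Proof.
have c1 : is_classifier (fun _ : T => 1 : R) by split=> // x; rewrite ler01 lexx.
transitivity (dis D P (fun _ : T => 1 : R)).
  by rewrite (dis_weight D).2//; apply: eq_Rintegral => x _; rewrite mul1r.
have rate1 S : 0 < fine (P (label_event S)) ->
    positive_rate P (fun=> 1) (label_event S) = 1.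
  move=> S0; rewrite positive_rateE// Rintegral_cst// mul1r.
  have -> : fine (sublaw P S setT) = fine (P (label_event S)).
    by rewrite /sublaw preimage_setT setTI.
  by rewrite divff// gt_eqF.
have pA0 := pA_gt0 p_gt0.
have group1 a : positive_rate P (fun=> 1) (dis_group D a) = 1.
  case: D => /=.
  - exact: (rate1 [set v | v.1 = a] (pA0 a)).
  - exact: (rate1 [set v | v.1 = a /\ v.2 = true] (p_gt0 a true)).
  - exact: (rate1 [set v | v.1 = a /\ v.2 = false] (p_gt0 a false)).
by rewrite /dis !group1 subrr.
Qed.

End fairness_integrals.

(** * Lagrangian duality for the reweighted Bayes classifier *)

Theorem theoremB6 (R : realType) (d : measure_display) (T : measurableType d)
    (P : probability (T * bool * bool)%type R)
    (etaY etaA : T -> R) (etaYA : bool -> T -> R)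
    (p_gt0 : forall a y, 0 < pAY P a y)
    (etaYP : cond_prob_version P [set z | tY z = true] setT etaY)
    (etaAP : cond_prob_version P [set z | tA z = true] setT etaA)
    (etaYAP : forall a,
      cond_prob_version P [set z | tY z = true] [set z | tA z = a] (etaYA a))
    (D : disparity)
    (etaY_pdf : has_pdf (lawX P) etaY)
    (w_pdf : has_pdf (lawX P) (weight D P etaA etaYA))
    (boundary0 : forall t : R,
      lawX P [set x | etaY x = 2^-1 + t / 2 * weight D P etaA etaYA x] = 0%E)
    (delta : R) (delta_ge0 : 0 <= delta)
    (Q : probability (T * bool * bool)%type R)
    (QP : is_reweighting D P
            (t_opt P etaY (weight D P etaA etaYA) delta) Q) :
  bayes_optimal Q `<=` fair_bayes_optimal D delta P.
Proof.
have [w_int disE] := dis_weight P _ _ etaAP etaYAP D.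
have Rw0 := Rintegral_weight P _ _ p_gt0 etaAP etaYAP D.
have riskPE := risk_etaY P _ etaYP.
have eta_int := etaY_integrable P _ etaYP.
set w := weight D P etaA etaYA in w_int disE Rw0 boundary0 QP *.
set t := t_opt _ _ _ _ in QP.
have [c c0 [K riskQE]] := risk_reweighting p_gt0 QP.
pose h := threshold_rule etaY w.
have ch s : is_classifier (h s) :=
  classifier_threshold_rule (lawX P) _ _ eta_int w_int s.
pose H s := \int[lawX P]_x (h s x * w x).
have [Ht tH] : `|H t| <= delta /\ t * H t = `|t| * delta.
  (* [threshold_dis] has the factors of the integrand in the other order; up to that, it is the
     disparity [H] of the threshold rule. *)
  have -> : t = xget 0 (argmin [set s | `|H s| <= delta] (fun s => `|s|)).
    rewrite /t /t_opt; congr (xget _ (argmin _ _)); apply/funext => s.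
    rewrite /mkset; congr (`|_| <= _ : Prop); apply: eq_Rintegral => x _.
    by rewrite mulrC.
  apply: least_multiplier => //.
  - exact: continuous_threshold_rule.
  - by move=> s u su; exact: threshold_rule_antitone.
  - exact: threshold_rule_crossing.
have LE f : is_classifier f ->
    risk P f + t * dis D P f =
    fine (P (label_event [set v | v.2 = true])) + lagrangian (lawX P) etaY w t f.
  by move=> cf; rewrite riskPE// disE// /lagrangian addrA.
move=> f [cf fmin].
have Lmin g : is_classifier g ->
    lagrangian (lawX P) etaY w t f <= lagrangian (lawX P) etaY w t g.
  move=> cg; have := fmin g cg; rewrite !riskQE// !LE//.
  by rewrite lerD2l ler_pM2l// lerD2l.
(* Every minimizer of the Lagrangian shares the disparity of the threshold rule, which is what makes
   [f] fair. *)
have disf : dis D P f = H t.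
  rewrite disE//; apply: lagrangian_min_Rintegral => //.
  exact: Lmin (ch t).
split=> [|g [cg gfair]]; first by split=> //; rewrite disf.
(* By slackness, the risk of [f] plus [|t| * delta] is at most the risk of [g] plus [t * dis D P g],
   whose last term is at most [|t| * delta] for fair [g]. *)
have := Lmin g cg; rewrite -(lerD2l (fine (P (label_event [set v | v.2 = true])))).
rewrite -!LE// disf tH => Lfg.
suff : t * dis D P g <= `|t| * delta by move: Lfg; lra.
by rewrite (le_trans (ler_norm _))// normrM ler_wpM2l.
Qed.
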